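(* Let $T\ge 1$ and assume that for all $t\in\{1,\dots,T\}$ we have $1\le|\mathcal A_t|<\infty$ and $r_t(i),\hat r_t(i),b_t(i)\in[0,1]$ for all $i\in\mathcal A_t$, and that there is $\omega>0$ with $\mathrm{OPT}_T\ge\omega T$. If $\alpha=1$, then $$\mathrm{CR}_T(\mathrm{RLA})\ge 1-\frac{2\kappa_T}{\omega},$$ irrespective of the size of the advice errors $\|\hat r_t-r_t\|_{\infty,\mathcal A_t}$.
   Context: Fix a horizon $T\in\mathbb N$, $T\ge1$, and a set of items $\mathcal I$. At each time $t\in\{1,\dots,T\}$ there is a finite feasible slate $\mathcal A_t\subseteq\mathcal I$, a reward function $r_t:\mathcal A_t\to\mathbb R$, a learned advice score $\hat r_t:\mathcal A_t\to\mathbb R$ and a conservative fallback score $b_t:\mathcal A_t\to\mathbb R$. The sequence $(\mathcal A_t,r_t,\hat r_t,b_t)_{t=1}^T$ is fixed (deterministic). A policy $\pi$ chooses $a_t^\pi\in\mathcal A_t$ at each $t$. Definitions: $W_T(\pi)=\sum_{t=1}^T r_t(a_t^\pi)$; $\mathrm{OPT}_T=\sum_{t=1}^T\max_{i\in\mathcal A_t}r_t(i)$; $\mathrm{CR}_T(\pi)=W_T(\pi)/\mathrm{OPT}_T$ whenever $\mathrm{OPT}_T>0$. For a function $f$ on $\mathcal A_t$, $\|f\|_{\infty,\mathcal A_t}=\max_{i\in\mathcal A_t}|f(i)|$. Average fallback error: $\kappa_T=\frac1T\sum_{t=1}^T\|b_t-r_t\|_{\infty,\mathcal A_t}$. For $\alpha\in[0,1]$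 the robust score is $s_t^\alpha(i)=(1-\alpha)\hat r_t(i)+\alpha b_t(i)$, and the robust learning-augmented policy RLA (with parameter $\alpha$) selects any $a_t^{\mathrm{RLA}}\in\arg\max_{i\in\mathcal A_t}s_t^\alpha(i)$ (arbitrary tie-breaking). *)

(* Defs.v *)
From HB Require Import structures.
From mathcomp Require Import all_boot all_order all_algebra.
From mathcomp Require Import finmap reals.

Set Implicit Arguments.
Unset Strict Implicit.
Unset Printing Implicit Defensive.

Import Order.TTheory GRing.Theory Num.Theory.

Local Open Scope fset_scope.
Local Open Scope ring_scope.

(* The maximum of [f] over a nonempty finite type.  Seeding the iterated max
   with a value of [f], and not with 0, makes this correct for real functions of
   any sign; the value is the junk value 0 when [X] is empty. *)
Definition fin_max (R : realType) (X : finType) (f : X -> R) : R :=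
  if [pick i : X] is Some i0 then \big[Num.max/f i0]_(i : X) f i else 0.

Definition argmax (R : realType) (X : finType) (f : X -> R) : {set X} :=
  [set i | [forall j, f j <= f i]].

Definition sup_norm (R : realType) (X : finType) (f : X -> R) : R :=
  fin_max (fun i => `|f i|).

(* Times 1, ..., T are the elements of ['I_T] (shifted by one).  Slates are
   finite sets of items, and functions on the slate at time t have the subtype
   [A t] as domain. *)
Definition slates (T : nat) (I : choiceType) : Type := 'I_T -> {fset I}.

Definition scores (R : realType) (T : nat) (I : choiceType)
  (A : slates T I) : Type := forall t : 'I_T, A t -> R.

(* The instance being deterministic, a policy is given by the items it picks. *)
Definition policy (T : nat) (I : choiceType) (A : slates T I) : Type :=
  forall t : 'I_T, A t.

Definition welfare (R : realType) (T : nat) (I : choiceType) (A : slates T I)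
  (r : scores R A) (p : policy A) : R := \sum_(t < T) r t (p t).

Definition OPT (R : realType) (T : nat) (I : choiceType) (A : slates T I)
  (r : scores R A) : R := \sum_(t < T) fin_max (r t).

(* Meaningful only when [0 < OPT r]. *)
Definition CR (R : realType) (T : nat) (I : choiceType) (A : slates T I)
  (r : scores R A) (p : policy A) : R := welfare r p / OPT r.

Definition kappa (R : realType) (T : nat) (I : choiceType) (A : slates T I)
  (b r : scores R A) : R :=
  T%:R^-1 * \sum_(t < T) sup_norm (fun i => b t i - r t i).

Definition robust_score (R : realType) (T : nat) (I : choiceType)
  (A : slates T I) (alpha : R) (rhat b : scores R A) : scores R A :=
  fun t i => (1 - alpha) * rhat t i + alpha * b t i.

(* Ties are broken arbitrarily: any selection of maximizers is an RLA policy. *)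
Definition is_RLA (R : realType) (T : nat) (I : choiceType) (A : slates T I)
  (alpha : R) (rhat b : scores R A) (p : policy A) : Prop :=
  forall t : 'I_T, p t \in argmax (robust_score alpha rhat b (t := t)).

(* Main.v *)
(** With [alpha = 1] the robust score is [b], so RLA maximizes [b t] at every
    time.  Passing from [r t] to [b t] and back costs at most the sup-norm
    distance each time, so RLA loses at most [2 * sup_norm (b t - r t)] at time
    [t], hence at most [2 T kappa] in total; dividing by [OPT >= omega T] gives
    the bound. *)
Require Import Defs.
From mathcomp Require Import all_boot all_order all_algebra.
From mathcomp Require Import finmap reals lra.

Import Order.TTheory GRing.Theory Num.Theory.

Local Open Scope fset_scope.
Local Open Scope ring_scope.

Lemma ge_fin_max {R : realType} {X : finType} (f : X -> R) (i : X) :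
  f i <= fin_max f.
Proof.
rewrite /fin_max; case: pickP => [i0 _|/(_ i)//].
exact: le_bigmax.
Qed.

(** The point [x0] rules out an empty [X], where the junk value 0 could exceed a negative [c]. *)
Lemma fin_max_le {R : realType} {X : finType} {f : X -> R} (x0 : X) (c : R) :
  (forall i, f i <= c) -> fin_max f <= c.
Proof.
rewrite /fin_max; case: pickP => [i0 _ fc|/(_ x0)//].
by apply: bigmax_le => // i _.
Qed.

Lemma fin_max_argmax_le {R : realType} {X : finType} {f g : X -> R} {x : X} :
  x \in argmax g -> fin_max f <= f x + 2 * sup_norm (fun i => g i - f i).
Proof.
rewrite inE => /forallP gx; apply: (fin_max_le x) => i.
(* With [e] the sup norm of [g - f], the chain is [f i <= g i + e <= g x + e <= f x + 2 * e]; each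
   absolute value contributes only one of its two sides. *)
have := ge_fin_max (fun j => `|g j - f j|) i.
have := ge_fin_max (fun j => `|g j - f j|) x.
rewrite -/(sup_norm _) !ler_norml => /andP[_ hx] /andP[hi _].
by have := gx i; lra.
Qed.

Lemma sup_norm_ge0 {R : realType} {X : finType} {f : X -> R} (x : X) :
  0 <= sup_norm f.
Proof. exact: le_trans (normr_ge0 (f x)) (ge_fin_max _ x). Qed.

Lemma OPT_le_welfare {R : realType} {I : choiceType} {T : nat}
  {A : slates T I} (r : scores R A) {b : scores R A} {p : policy A} :
  (forall t, p t \in argmax (b t)) ->
  OPT r <= welfare r p + 2 * \sum_(t < T) sup_norm (fun i => b t i - r t i).
Proof.
move=> pb; rewrite /OPT /welfare mulr_sumr -big_split.
by apply: ler_sum => t _; exact: fin_max_argmax_le (pb t).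
Qed.

Theorem corollary3 (R : realType) (I : choiceType) (T : nat) (hT : (1 <= T)%N)
  (A : slates T I) (hA : forall t : 'I_T, (1 <= #|` A t|)%N)
  (r rhat b : scores R A)
  (hr : forall (t : 'I_T) (i : A t), 0 <= r t i <= 1)
  (hrhat : forall (t : 'I_T) (i : A t), 0 <= rhat t i <= 1)
  (hb : forall (t : 'I_T) (i : A t), 0 <= b t i <= 1)
  (omega : R) (homega : 0 < omega) (hOPT : omega * T%:R <= OPT r)
  (alpha : R) (halpha : alpha = 1)
  (RLA : policy A) (hRLA : is_RLA alpha rhat b RLA) :
  1 - 2%:R * kappa b r / omega <= CR r RLA.
Proof.
have T_gt0 : 0 < T%:R :> R by rewrite ltr0n.
have wT_gt0 : 0 < omega * T%:R by rewrite mulr_gt0.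
have OPT_gt0 : 0 < OPT r := lt_le_trans wT_gt0 hOPT.
have RLA_b t : RLA t \in argmax (b t).
  have := hRLA t; rewrite !inE halpha => /forallP h.
  apply/forallP => j; have := h j.
  by rewrite /robust_score subrr !mul0r !add0r !mul1r.
have := OPT_le_welfare r RLA_b.
rewrite /CR /kappa; set e := \sum_(t < T) _ => OPT_le.
(* The sign of [e] matters: shrinking the denominator from [OPT r] to [omega * T%:R] enlarges the
   loss ratio only if its numerator is nonnegative. *)
have e_ge0 : 0 <= e by apply: sumr_ge0 => t _; exact: sup_norm_ge0 (RLA t).
have -> : 2%:R * (T%:R^-1 * e) / omega = 2 * e / (omega * T%:R).
  by rewrite invfM [T%:R^-1 * e]mulrC !mulrA mulrAC.
have le_ratio : 2 * e / OPT r <= 2 * e / (omega * T%:R).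
  by rewrite ler_wpM2l ?mulr_ge0// lef_pV2.
(* It remains to bound [1 - 2 * e / OPT r]; clearing the positive denominator [OPT r] turns this
   into [OPT_le]. *)
apply: (le_trans (lerB (lexx 1) le_ratio)).
by rewrite ler_pdivlMr// mulrBl mul1r divfK ?gt_eqF// lerBlDr.
Qed.
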